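(* For every $d\in\mathbb{N}$ and $\beta>0$ there exist $\bar\epsilon=\bar\epsilon(d,\beta)>0$, $\bar\mu=\bar\mu(d,\beta)>0$ and $\alpha=\alpha(d,\beta)>0$ such that if $X$ is a $d$-complex in which the link $X_\sigma$ is a $\beta$-coboundary expander for every $\sigma\in X$ with $1\le|\sigma|\le d-1$, and $X_\sigma$ is an $\alpha$-skeleton expander for every $\sigma\in X$ with $0\le|\sigma|\le d-1$, then for every $0\le k\le d-1$ and every locally minimal $A\in C^k$ with $\|A\|\le\bar\mu$ one has $\|\delta A\|\ge\bar\epsilon\,\|A\|$.
   Context: A $d$-complex is a finite pure $d$-dimensional simplicial complex $X$; faces are sets of vertices, the empty set is a face, $|\sigma|$ is the number of vertices of $\sigma$; $X(k)$ is the set of $k$-faces. $C^k=C^k(X;\mathbb{F}_2)$, identified with subsets of $X(k)$; $\delta\colon C^k\to C^{k+1}$, $(\delta f)(\tau)=\sum_{\sigma\subset\tau}f(\sigma)$; $B^k=\mathrm{Im}\,\delta^{k-1}$. Weight $w(\sigma)=\frac{|\{F\in X(d):\sigma\subset F\}|}{\binom{d+1}{|\sigma|}|X(d)|}$, norm $\|A\|=\sum_{\sigma\in A}w(\sigma)$. The link $X_\sigma=\{\tau\in X:\tau\cap\sigma=\emptyset,\tau\cup\sigma\in X\}$ is a pure $(d-|\sigma|)$-complex with its own cochains $C^k_\sigma$, coboundary $\delta_\sigma$ and norm $\|\cdot\|_\sigma$ defined by the same recipe ($X_\emptyset=X$). The localization of $A\in C^k$ at $\sigma$ is $I_\sigma(A)=\{\tau\in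 X_\sigma:\tau\sqcup\sigma\in A\}\in C^{k-|\sigma|}_\sigma$. A cochain $A\in C^k(Y)$ of a complex $Y$ is minimal if $\|A\|=\min_{b\in B^k(Y)}\|A+b\|$; $A\in C^k(X)$ is locally minimal if for every nonempty $\sigma\in X$, $I_\sigma(A)$ is minimal in $X_\sigma$. A complex $Y$ of dimension $m$ is a $\beta$-coboundary expander if for every $0\le k\le m-1$ and every $A\in C^k(Y)\setminus B^k(Y)$, $\|\delta A\|\ge\beta\min_{b\in B^k(Y)}\|A+b\|$. $Y$ is an $\alpha$-skeleton expander if for every $A\subset Y(0)$, $\|E(A,A)\|\le4(\|A\|^2+\alpha\|A\|)$, where $E(A,A)$ is the set of edges of $Y$ with both endpoints in $A$ (norms of $Y$). *)

(* Defs.v *)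
From HB Require Import structures.
From mathcomp Require Import all_boot all_order all_algebra.
Set Implicit Arguments. Unset Strict Implicit. Unset Printing Implicit Defensive.
Import Order.TTheory GRing.Theory Num.Theory.
Local Open Scope ring_scope.

Section Complexes.
Variable V : finType.
Variable R : realFieldType.

Definition cplx := {set {set V}}.

(* X is a finite pure d-dimensional simplicial complex (the empty face is a face,
   downward closed, every face has <= d+1 vertices and lies in a face with d+1
   vertices; since the empty set is a face, X(d) is nonempty). *)
Definition is_dcomplex (d : nat) (X : cplx) : Prop :=
  [/\ set0 \in X,
      (forall s t : {set V}, t \in X -> s \subset t -> s \in X),
      (forall s : {set V}, s \in X -> (#|s| <= d.+1)%N) &
      (forall s : {set V}, s \in X -> exists2 F, F \in X & (#|F| == d.+1) && (s \subset F))].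

(* faces with exactly n vertices, i.e. X(n-1) *)
Definition facesn (X : cplx) (n : nat) : cplx := [set s in X | #|s| == n].

Definition delta (X : cplx) (n : nat) (f : cplx) : cplx :=
  [set t in facesn X n.+1 | odd #|[set s in f | (s \subset t) && (#|s| == n)]|].

(* coboundaries among cochains on faces with m vertices:  B^{m-1} = Im delta^{m-2};
   for m = 0 (k = -1) this is the zero space. *)
Definition cobd (X : cplx) (m : nat) : {set cplx} :=
  if m is m'.+1 then [set delta X m' f | f in powerset (facesn X m')]
  else [set set0].

(* addition in F_2 cochains = symmetric difference *)
Definition symdiff (A B : cplx) : cplx := (A :\: B) :|: (B :\: A).

Definition weight (X : cplx) (dim : nat) (s : {set V}) : R :=
  (#|[set F in facesn X dim.+1 | s \subset F]|)%:R /
  (('C(dim.+1, #|s|) * #|facesn X dim.+1|)%N)%:R.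

Definition norm (X : cplx) (dim : nat) (A : cplx) : R :=
  \sum_(s in A) weight X dim s.

(* min_{b in B^{m-1}} ||A + b||  (0 is always a coboundary) *)
Definition mindist (X : cplx) (dim m : nat) (A : cplx) : R :=
  \big[Order.min/norm X dim A]_(b in cobd X m) norm X dim (symdiff A b).

Definition minimal (X : cplx) (dim m : nat) (A : cplx) : Prop :=
  norm X dim A = mindist X dim m A.

Definition link (X : cplx) (sg : {set V}) : cplx :=
  [set t in X | [disjoint t & sg] && (t :|: sg \in X)].

Definition loc (X : cplx) (sg : {set V}) (A : cplx) : cplx :=
  [set t in link X sg | t :|: sg \in A].

(* A in C^k(X), X of dimension d, is locally minimal.  Link X_sigma has dimension
   d - |sigma|, and I_sigma(A) lives on faces with k+1-|sigma| vertices (when this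
   is <= 0 the truncated value 0 gives a trivially satisfied condition, as in the
   paper where B^{j} = 0 for j < 0). *)
Definition locally_minimal (X : cplx) (d k : nat) (A : cplx) : Prop :=
  forall sg : {set V}, sg \in X -> sg != set0 ->
    minimal (link X sg) (d - #|sg|) (k.+1 - #|sg|) (loc X sg A).

Definition cob_expander (Y : cplx) (m : nat) (beta : R) : Prop :=
  forall k, (k < m)%N -> forall A : cplx, A \subset facesn Y k.+1 ->
    A \notin cobd Y k.+1 ->
    beta * mindist Y m k.+1 A <= norm Y m (delta Y k.+1 A).

Definition EAA (Y : cplx) (A : cplx) : cplx :=
  [set e in facesn Y 2 | [forall v in e, [set v] \in A]].

Definition skel_expander (Y : cplx) (m : nat) (alpha : R) : Prop :=
  forall A : cplx, A \subset facesn Y 1 ->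
    norm Y m (EAA Y A) <= 4%:R * (norm Y m A ^+ 2 + alpha * norm Y m A).

End Complexes.

(* Main.v *)
Require Import Defs.
From HB Require Import structures.
From mathcomp Require Import all_boot all_order all_algebra.
From mathcomp Require Import zify ring lra.
Import Order.TTheory GRing.Theory Num.Theory.
Set Implicit Arguments. Unset Strict Implicit. Unset Printing Implicit Defensive.
Local Open Scope ring_scope.

(** Call the faces of [A] fat and, descending in dimension, call a face fat if a
    large enough proportion of the faces one dimension up that contain it are fat.
    A small [A] leaves the empty face thin.  Skeleton expansion of the links of
    thin faces shows that the (k+1)-faces containing two adjacent fat faces with
    a thin intersection (the degenerate ones) have total weight at most a small
    multiple of [||A||].  From every face of [A] one descends through fat faces
    to a terminal one, [s]; let [L_s] be the set of faces of [A] that descend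
    to [s].  In a nondegenerate (k+1)-face containing a member of [L_s], all
    faces of [A] belong to [L_s], so there [delta_s (I_s L_s)] is [delta A].  As
    a subset of the minimal cochain [I_s A], [I_s L_s] is minimal, and
    coboundary expansion of the link of [s] gives the bound, after summing
    over [s].  Counting facets replaces the norms of all links by multiples of
    the single function [deg]. *)

(** * Facet counts, weights and minimality *)

Section Counting.
Variables (V : finType) (R : realFieldType).
Implicit Types (s t : {set V}) (X A B : cplx V).

Lemma setU_disjointK s t : [disjoint t & s] -> (t :|: s) :\: s = t.
Proof.
by move=> dts; rewrite setDUl setDv setU0; apply/setDidPl.
Qed.

Lemma setDUK s t : s \subset t -> t :\: s :|: s = t.
Proof.
move=> st; apply/setP => x; rewrite !inE.
by case: (boolP (x \in s)) => [/(subsetP st)->|]; rewrite ?orbF.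
Qed.

Lemma disjoint_setD s t : [disjoint t :\: s & s].
Proof. by rewrite -setI_eq0 setIC setIDA setDIl setDv set0I. Qed.

Lemma card_setU_disjoint s t :
  [disjoint t & s] -> #|t :|: s| = (#|t| + #|s|)%N.
Proof. by rewrite -leq_card_setU => /eqP. Qed.

(** After exchanging the sums, a face of [B] arises once for each of its vertices, by deleting it,
    hence at most [n] times. *)
Lemma sum_add_vertex (P B : {pred {set V}}) (g : {set V} -> R) (n : nat) :
  (forall s, 0 <= g s) -> (forall s, s \in B -> #|s| <= n)%N ->
  \sum_(s in P) \sum_(v | (v \notin s) && (v |: s \in B)) g (v |: s) <=
  n%:R * \sum_(s in B) g s.
Proof.
move=> g0 leB.
apply: (@le_trans _ R
  (\sum_(s : {set V}) \sum_(v : V | (v \notin s) && (v |: s \in B)) g (v |: s))).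
  rewrite [leRHS](bigID (mem P)) /= lerDl; apply: sumr_ge0 => s _.
  by apply: sumr_ge0.
rewrite (exchange_big_dep predT) //= mulr_sumr.
have step (v : V) : \sum_(s : {set V} | (v \notin s) && (v |: s \in B)) g (v |: s) =
              \sum_(s : {set V} | (s \in B) && (v \in s)) g s.
  rewrite [RHS](reindex_onto (fun s : {set V} => v |: s) (fun s => s :\ v)) /=.
    apply: eq_bigl => s; rewrite setU11 andbT andbC; congr andb.
    apply/idP/eqP => [vs|<-]; last by rewrite !inE eqxx.
    by rewrite setU1K.
  by move=> s /andP[_ vs]; rewrite setD1K.
rewrite (eq_bigr _ (fun v _ => step v)) (exchange_big_dep (mem B)) /=; last first.
  by move=> v s _ /andP[].
apply: ler_sum => s sB; rewrite (eq_bigl (mem s)); last first.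
  by move=> v; rewrite sB.
by rewrite sumr_const -[leLHS]mulr_natl; apply: ler_wpM2r => //; rewrite ler_nat leB.
Qed.

Definition deg X (d : nat) s : R :=
  #|[set F in facesn X d.+1 | s \subset F]|%:R.

Lemma deg_ge0 X d s : 0 <= deg X d s.
Proof. exact: ler0n. Qed.

Lemma degE X d s : deg X d s = \sum_(F in facesn X d.+1 | s \subset F) 1.
Proof.
rewrite /deg -sum1_card natr_sum; apply: eq_bigl => F; by rewrite inE.
Qed.

Lemma deg0 X d : deg X d set0 = #|facesn X d.+1|%:R.
Proof.
by rewrite /deg; congr (_%:R); apply: eq_card => F; rewrite inE sub0set andbT.
Qed.

(** A facet containing [s] is counted once for each [t] between [s] and it, and has only [2 ^ d.+1]
    subsets. *)
Lemma sum_deg_supersets X d s :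
  \sum_(t : {set V} | s \subset t) deg X d t <= (2 ^ d.+1)%:R * deg X d s.
Proof.
under eq_bigr do rewrite degE.
rewrite degE (exchange_big_dep (fun F => (F \in facesn X d.+1) && (s \subset F))) /=.
  rewrite mulr_sumr; apply: ler_sum => F /andP[FX sF]; rewrite mulr1.
  rewrite sumr_const ler_nat.
  move: FX; rewrite inE => /andP[_ /eqP <-]; rewrite -card_powerset.
  apply: subset_leq_card; apply/subsetP => t.
  by rewrite inE unfold_in /= => /and3P[].
by move=> t F st /andP[-> tF]; rewrite (subset_trans st tF).
Qed.

Lemma facesnP X n s : reflect (s \in X /\ #|s| = n) (s \in facesn X n).
Proof. by rewrite inE; apply: (iffP andP) => -[? /eqP]. Qed.

Lemma linkP X s t :
  reflect [/\ t \in X, [disjoint t & s] & t :|: s \in X] (t \in link X s).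
Proof. by rewrite inE; apply: and3P. Qed.

(** Joining with [s] maps the facets of the link that contain [t] bijectively onto the facets of [X]
    that contain [t :|: s]. *)
Lemma deg_link X d s t : is_dcomplex d X -> (#|s| <= d)%N ->
  [disjoint t & s] ->
  deg (link X s) (d - #|s|) t = deg X d (t :|: s).
Proof.
move=> [_ dcl _ _] sd dts; rewrite /deg; congr (_%:R).
rewrite -[LHS](@card_in_imset _ _ (fun F : {set V} => F :|: s)); last first.
  move=> F G; rewrite !inE => /andP[/andP[/and3P[_ dF _] _] _].
  move=> /andP[/andP[/and3P[_ dG _] _] _] e.
  by rewrite -(setU_disjointK dF) -(setU_disjointK dG) e.
apply: eq_card => G; apply/imsetP/idP.
  move=> [F]; rewrite !inE => /andP[/andP[/and3P[_ dF FsX] /eqP cF] tF ->].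
  rewrite FsX setSU // card_setU_disjoint // cF andbT.
  by apply/eqP; lia.
rewrite !inE subUset => /andP[/andP[GX /eqP cG] /andP[tG sG]].
exists (G :\: s); last by rewrite setDUK.
rewrite !inE (dcl _ _ GX (subsetDl _ _)).
have dGs := disjoint_setD s G; have GsE := setDUK sG.
rewrite dGs GsE GX subsetD tG dts !andbT.
by have := card_setU_disjoint dGs; rewrite GsE cG => e; apply/eqP; lia.
Qed.

Lemma weight_link X d s t : is_dcomplex d X -> (#|s| <= d)%N ->
  t \in link X s ->
  weight R (link X s) (d - #|s|) t =
  deg X d (t :|: s) / ('C((d - #|s|).+1, #|t|)%:R * deg X d s).
Proof.
move=> hX sd /linkP[_ dts _].
rewrite /weight natrM -[#|facesn _ _|%:R]deg0 deg_link ?set0U //; last first.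
  by rewrite -setI_eq0 set0I.
by rewrite -[#|_|%:R]/(deg _ _ _) deg_link.
Qed.

Lemma weight_deg X d s :
  weight R X d s = deg X d s / ('C(d.+1, #|s|)%:R * deg X d set0).
Proof. by rewrite /weight natrM deg0. Qed.

Lemma deg_gt0 X d s : is_dcomplex d X -> s \in X -> 0 < deg X d s.
Proof.
move=> [_ _ _ pur] sX; rewrite ltr0n; apply/card_gt0P.
have [F FX /andP[cF sF]] := pur _ sX.
by exists F; rewrite !inE FX cF.
Qed.

Lemma weight_ge0 X d s : 0 <= weight R X d s.
Proof. by rewrite divr_ge0 // ler0n. Qed.

Lemma norm_ge0 X d A : 0 <= norm R X d A.
Proof. by apply: sumr_ge0 => s _; apply: weight_ge0. Qed.

Lemma le_norm X d A B : A \subset B -> norm R X d A <= norm R X d B.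
Proof.
move=> /setIidPr AB; rewrite /norm [leRHS](big_setID A) /= AB lerDl.
by apply: sumr_ge0 => s _; apply: weight_ge0.
Qed.

Lemma norm_setU X d A B : norm R X d (A :|: B) <= norm R X d A + norm R X d B.
Proof.
rewrite /norm (big_setID A) /= [X in X + _](_ : _ = norm R X d A); last first.
  by rewrite /norm setUK.
by rewrite lerD2l; apply: le_norm; rewrite setDUl setDv set0U subsetDl.
Qed.

Lemma minimal_le X m n A b : minimal R X m n A -> b \in cobd X n ->
  norm R X m A <= norm R X m (symdiff A b).
Proof. by rewrite /minimal /mindist => -> bB; apply: bigmin_le_cond. Qed.

(** [symdiff A b] lies in the union of [symdiff B b] and [A :\: B], so a coboundary that shortens
    [B] also shortens [A]. *)
Lemma minimal_subset X m n A B b : B \subset A -> minimal R X m n A ->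
  b \in cobd X n -> norm R X m B <= norm R X m (symdiff B b).
Proof.
move=> BA mA bB; have h := minimal_le mA bB.
have eA : norm R X m A = norm R X m B + norm R X m (A :\: B).
  rewrite /norm (big_setID B) /=; congr (_ + _).
  by apply: eq_bigl => x; rewrite (setIidPr BA).
rewrite -(lerD2r (norm R X m (A :\: B))) -eA; apply: le_trans h _.
apply: le_trans (norm_setU _ _ _ _); apply: le_norm.
apply/subsetP => x; rewrite !inE; have := subsetP BA x.
by case: (x \in A) (x \in B) (x \in b) => [] [] [] // /(_ isT).
Qed.

(* A subset of a minimal cochain is minimal, so the expansion inequality holds
   for it without the hypothesis of not being a coboundary. *)
Lemma expander_minimal_subset X m n A B (beta : R) : 0 <= beta ->
  cob_expander X m beta -> (n < m)%N -> B \subset facesn X n.+1 ->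
  B \subset A -> minimal R X m n.+1 A ->
  beta * norm R X m B <= norm R X m (delta X n.+1 B).
Proof.
move=> b0 ex nm Bf BA mA.
have [Bc|Bc] := boolP (B \in cobd X n.+1); last first.
  apply: le_trans (ex _ nm _ Bf Bc); apply: ler_wpM2l => //.
  rewrite /mindist; apply/bigmin_geP; split=> // b bB.
  exact: minimal_subset mA bB.
(* A coboundary [B] cancels itself, so minimality makes its norm zero. *)
have := minimal_subset BA mA Bc.
have -> : symdiff B B = set0 by rewrite /symdiff setDv setU0.
rewrite {2}/norm big_set0 => B0; apply: le_trans (norm_ge0 _ _ _).
by rewrite mulr_ge0_le0.
Qed.

End Counting.

(** * Descending chains through a graded family of faces *)

Section Ladders.
Variables (V : finType) (F : nat -> cplx V).
Implicit Types (a s t r : {set V}) (u v w : V) (j : nat).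

(** The descents of the overview, one vertex dropped per step; [F] will be the family of fat
    faces. *)
Fixpoint ladder j a s : bool :=
  if j is j'.+1 then
    (s \in F j) && [exists v, (v \notin s) && ladder j' a (v |: s)]
  else (s == a) && (a \in F 0).

Definition terminal j s : bool :=
  (s \in F j) && [forall v in s, s :\ v \notin F j.+1].

Lemma ladder_in j a s : ladder j a s -> s \in F j.
Proof. by case: j => [/andP[/eqP-> ]|j /andP[]]. Qed.

Lemma ladder_sub j a s : ladder j a s -> s \subset a.
Proof.
elim: j s => [s /andP[/eqP-> _] //|j IH s /andP[_ /existsP[v /andP[_ /IH]]]].
by apply: subset_trans; apply: subsetUr.
Qed.

(** A ladder of maximal length ends at a terminal face, since any further step would lengthen it. *)
Lemma exists_terminal n a : a \in F 0 -> (forall j, (n < j)%N -> F j = set0) ->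
  exists j s, terminal j s && ladder j a s.
Proof.
move=> aF Fn.
pose P j := [exists s, ladder j a s].
have exP : exists j, P j by exists 0%N; apply/existsP; exists a; rewrite /= eqxx.
have leP j : P j -> (j <= n)%N.
  move=> /existsP[s /ladder_in sF]; rewrite leqNgt; apply/negP => /Fn Fj.
  by rewrite Fj inE in sF.
case: (ex_maxnP exP leP) => j /existsP[s ls] maxj.
exists j, s; rewrite ls /terminal (ladder_in ls) andbT /=.
apply/forall_inP => v vs; apply/negP => svF.
suff /maxj : P j.+1 by rewrite ltnn.
apply/existsP; exists (s :\ v); rewrite /= svF /=.
by apply/existsP; exists v; rewrite !inE eqxx /= setD1K.
Qed.

(** The form in which nondegeneracy of [t] is used: [r] is the intersection of two adjacent members
    of one level. *)
Definition cap_closed_in t : Prop := forall j r u w,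
  u != w -> u \notin r -> w \notin r -> u |: r \in F j -> w |: r \in F j ->
  [set u; w] :|: r \subset t -> r \in F j.+1.

(* Deleting [v] from every rung of a ladder of [t :\ u] that contains it gives
   a ladder of [t :\ v]. *)
Lemma ladder_switch t u v j s : cap_closed_in t -> u \in t -> v \in t ->
  t :\ u \in F 0 -> t :\ v \in F 0 -> ladder j (t :\ u) s ->
  if v \in s then ladder j.+1 (t :\ v) (s :\ v) else ladder j (t :\ v) s.
Proof.
move=> mt ut vt uF vF.
have [<-|uv] := eqVneq u v.
  move=> ls; case: ifP => // us; have /subsetP/(_ u us) := ladder_sub ls.
  by rewrite !inE eqxx.
elim: j s => [s /andP[/eqP-> _]|j IH s].
  rewrite !inE eq_sym uv vt /=.
  have e1 : u |: (t :\ u :\ v) = t :\ v.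
    have -> : t :\ u :\ v = t :\ v :\ u by rewrite !setDDl [X in _ :\: X]setUC.
    by rewrite setD1K // !inE uv.
  have e2 : v |: (t :\ u :\ v) = t :\ u by rewrite setD1K // !inE eq_sym uv.
  (* Base case: [t :\ u] and [t :\ v] are adjacent, and their intersection ends the new ladder. *)
  have -> : t :\ u :\ v \in F 1.
    apply: (mt 0%N _ u v) => //; rewrite ?e1 ?e2 // ?inE ?eqxx ?andbF //.
    rewrite -setUA e2 setD1K //.
  by apply/existsP; exists u; rewrite e1 eqxx vF !inE eqxx andbF.
move=> /andP[sF /existsP[w /andP[ws]]] lw.
have := IH _ lw; rewrite in_setU1.
(* If the last step deleted [v] itself, the switched ladder already ends at [s]. *)
have [->|vw] := eqVneq v w => /=.
  by rewrite (negPf ws) setU1K // => /andP[-> ->].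
case: ifP => vs l'; last by rewrite /= sF /=; apply/existsP; exists w; rewrite ws.
have e1 : (w |: s) :\ v = w |: (s :\ v).
  by apply/setP => x; rewrite !inE; case: (eqVneq x v) => [->|] //=;
    rewrite (negPf vw).
rewrite e1 in l'.
have st : w |: s \subset t.
  by apply: subset_trans (ladder_sub lw) (subD1set _ _).
(* The faces [s] and [w |: (s :\ v)], the latter from the switched ladder, are adjacent and meet in
   [s :\ v]. *)
have svF : s :\ v \in F j.+2.
  apply: (mt _ _ w v); rewrite ?setD1K // ?inE ?eqxx //.
  - by rewrite eq_sym.
  - by rewrite (negPf ws) andbF.
  - by case/andP: l'.
  - by rewrite -setUA setD1K.
apply/andP; split=> //; apply/existsP; exists w.
by rewrite !inE (negPf ws) andbF.
Qed.

(** Were [v] in [s], the switched ladder would end at [s :\ v] one level further, against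
    terminality. *)
Lemma ladder_switch_terminal t u v j s : cap_closed_in t -> u \in t -> v \in t ->
  t :\ u \in F 0 -> t :\ v \in F 0 -> terminal j s ->
  ladder j (t :\ u) s -> ladder j (t :\ v) s.
Proof.
move=> mt ut vt uF vF /andP[_ /forall_inP ts] /(ladder_switch mt ut vt uF vF).
by case: ifP => // /ts /negPf svF /ladder_in; rewrite svF.
Qed.

End Ladders.

Lemma subset_codim1 (V : finType) (a t : {set V}) :
  a \subset t -> #|t| = #|a|.+1 -> exists2 u, u \in t & a = t :\ u.
Proof.
move=> sat ct; have /eqP/cards1P[u tau] : #|t :\: a| = 1%N.
  by have := cardsID a t; rewrite (setIidPr sat) ct; lia.
exists u; first by have := set11 u; rewrite -tau inE => /andP[].
by rewrite -tau setDDr setDv set0U; apply/esym/setIidPr.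
Qed.

Lemma sum_cover (R : realFieldType) (I T : finType) (U : {pred T}) (P : pred I)
    (Q : I -> pred T) (g : T -> R) : (forall t, 0 <= g t) ->
  (forall t, t \in U -> exists2 i, P i & Q i t) ->
  \sum_(t in U) g t <= \sum_(i | P i) \sum_(t | Q i t) g t.
Proof.
move=> g0 cov; rewrite (exchange_big_dep predT) //=.
rewrite [leRHS](bigID (mem U)) /= -[leLHS]addr0; apply: lerD; last first.
  by apply: sumr_ge0 => t _; apply: sumr_ge0.
apply: ler_sum => t tU; have [i Pi Qi] := cov _ tU.
rewrite (bigD1 i) /= ?Pi // lerDl; exact: sumr_ge0.
Qed.

(** * Norms of links and skeleton expansion in terms of [deg] *)

Section Norms.
Variables (V : finType) (R : realFieldType).
Variables (X : cplx V) (d : nat).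
Hypothesis hX : is_dcomplex d X.
Implicit Types (a s t r : {set V}) (B : cplx V).

Local Notation deg := (deg R X d).

Lemma norm_link s n B : (#|s| <= d)%N -> B \subset facesn (link X s) n ->
  norm R (link X s) (d - #|s|) B =
  (\sum_(t in B) deg (t :|: s)) / ('C((d - #|s|).+1, n)%:R * deg s).
Proof.
move=> sd /subsetP Bn; rewrite /norm mulr_suml; apply: eq_bigr => t tB.
by have /facesnP[tl <-] := Bn _ tB; rewrite weight_link.
Qed.

Lemma norm_deg n B : B \subset facesn X n ->
  norm R X d B = (\sum_(t in B) deg t) / ('C(d.+1, n)%:R * deg set0).
Proof.
move=> /subsetP Bn; rewrite /norm mulr_suml; apply: eq_bigr => t tB.
by have /facesnP[_ <-] := Bn _ tB; rewrite weight_deg.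
Qed.

Definition nbrs B r : {set V} := [set v | (v \notin r) && (v |: r \in B)].

(** The hypothesis bounds by [c] the norm [x] of the vertex set in the link, so [x ^+ 2 + alpha * x]
    is at most [(c + alpha) * x]. Comparing the binomials for edges and for vertices costs the
    factor [d]. *)
Lemma skel_expander_deg r B (alpha c : R) : r \in X -> (#|r| < d)%N ->
  B \subset X -> 0 <= alpha -> 0 <= c ->
  skel_expander (link X r) (d - #|r|) alpha ->
  \sum_(v in nbrs B r) deg (v |: r) <= c * deg r ->
  \sum_(e in EAA (link X r) (set1 @: nbrs B r)) deg (e :|: r) <=
  (4 * d)%:R * (c + alpha) * \sum_(v in nbrs B r) deg (v |: r).
Proof.
move=> rX rd BX al0 c0 sk.
have [_ dcl _ _] := hX.
have Nf : set1 @: nbrs B r \subset facesn (link X r) 1.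
  apply/subsetP => _ /imsetP[v + ->]; rewrite inE => /andP[vr vB].
  have vX := subsetP BX _ vB.
  apply/facesnP; rewrite cards1; split=> //; apply/linkP; split=> //.
    by apply: dcl vX _; rewrite sub1set setU11.
  by rewrite disjoints1.
have Ef : EAA (link X r) (set1 @: nbrs B r) \subset facesn (link X r) 2.
  by apply/subsetP => e; rewrite inE => /andP[].
have := sk _ Nf; rewrite (norm_link (ltnW rd) Nf) (norm_link (ltnW rd) Ef).
rewrite big_imset /=; last by move=> u v _ _ /set1_inj.
have := deg_gt0 R hX rX; set D := deg r.
set S2 := \sum_(e in _) _; set S := \sum_(v in _) _; set m := (d - #|r|)%N.
rewrite bin1 => D0 + Sc.
have S0 : 0 <= S by apply: sumr_ge0 => v _; apply: deg_ge0.
set x := S / _; set C := 'C(_, _)%:R.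
have m0 : 0 < (m.+1)%:R :> R by rewrite ltr0n.
have C0 : 0 < C by rewrite ltr0n bin_gt0 /m; lia.
have Cd : C <= d%:R * m.+1%:R.
  rewrite -natrM ler_nat bin2 /=.
  have := half_leq (leqnn (m.+1 * m)); rewrite /m; nia.
have x0 : 0 <= x by rewrite divr_ge0 // mulr_ge0 // ltW.
have xc : x <= c.
  rewrite ler_pdivrMr ?mulr_gt0 //; apply: le_trans Sc _.
  rewrite mulrCA mulrA -[leLHS]mul1r -mulrA; apply: ler_wpM2r.
    by rewrite mulr_ge0 // ltW.
  by rewrite ler1n.
rewrite ler_pdivrMr ?mulr_gt0 // => h; apply: le_trans h _.
have -> : S = x * (m.+1%:R * D) by rewrite /x divfK // gt_eqF // mulr_gt0.
have xx : x ^+ 2 + alpha * x <= (c + alpha) * x.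
  by rewrite expr2 -mulrDl; apply: ler_wpM2r => //; rewrite lerD2r.
apply: (@le_trans _ R (4 * ((c + alpha) * x) * (C * D))).
  by apply: ler_wpM2r; rewrite ?mulr_ge0 ?(ltW D0) ?(ltW C0) // ler_wpM2l.
apply: (@le_trans _ R (4 * ((c + alpha) * x) * (d%:R * m.+1%:R * D))).
  apply: ler_wpM2l; last by apply: ler_wpM2r => //; apply: ltW.
  by rewrite mulr_ge0 // mulr_ge0 // addr_ge0.
by rewrite natrM le_eqVlt; apply/orP; left; apply/eqP; ring.
Qed.

End Norms.

(** * Fat faces and the total degree of the degenerate faces *)

Section FatFaces.
Variables (V : finType) (R : realFieldType).
Variables (X : cplx V) (d : nat).
Hypothesis hX : is_dcomplex d X.
Variables (k : nat) (A : cplx V) (eta alpha : R).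
Hypothesis kd : (k < d)%N.
Hypothesis Ak : A \subset facesn X k.+1.
Hypotheses (eta_gt0 : 0 < eta) (alpha_ge0 : 0 <= alpha).
Hypothesis alpha_le : forall j, (j <= k)%N -> alpha <= eta ^+ (2 ^ j).
Implicit Types (a s t r : {set V}) (B : cplx V) (j : nat).

Local Notation deg := (deg R X d).

(* [fat j] consists of faces with [k + 1 - j] vertices.  The threshold is squared
   at each level, so that it absorbs the factor lost in [fat_sum] with a factor
   [eta] to spare. *)
Fixpoint fat j : cplx V :=
  if j is j'.+1 then
    [set s in X | (#|s| + j == k.+1)%N &&
      (eta ^+ (2 ^ j') * deg s <= \sum_(v in nbrs (fat j') s) deg (v |: s))]
  else A.

Lemma fat_card j s : s \in fat j -> s \in X /\ (#|s| + j = k.+1)%N.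
Proof.
case: j => [/(subsetP Ak)/facesnP[-> ->]|j]; first by rewrite addn0.
by rewrite inE => /and3P[-> /eqP].
Qed.

Lemma fat_sub j : fat j \subset X.
Proof. by apply/subsetP => s /fat_card[]. Qed.

(** The threshold charges a fat face to the fat faces one vertex larger, each charged at most [d.+1]
    times. Of the two equal factors of [eta ^+ (2 ^ j.+1)], one pays for the threshold and the other
    enters the induction hypothesis. *)
Lemma fat_sum j : \sum_(s in fat j) deg s * eta ^+ (2 ^ j) <=
  (d.+1)%:R ^+ j * (eta * \sum_(s in A) deg s).
Proof.
elim: j => [|j IH]; first by rewrite expr0 mul1r expr1 -mulr_suml mulrC.
have e0 : 0 <= eta ^+ (2 ^ j) by rewrite exprn_ge0 // ltW.
rewrite exprS -mulrA; apply: le_trans (ler_wpM2l (ler0n _ _) IH).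
rewrite -!mulr_suml expnS mul2n -addnn exprD 2!mulrA; apply: ler_wpM2r => //.
rewrite mulr_suml.
apply: le_trans (sum_add_vertex (mem (fat j.+1)) (deg_ge0 R X d) _).
  apply: ler_sum => s; rewrite inE mulrC => /and3P[_ _ h]; apply: le_trans h _.
  by rewrite le_eqVlt; apply/orP; left; apply/eqP/eq_bigl => v; rewrite inE.
by move=> s /(subsetP (fat_sub j)); have [_ _ + _] := hX; apply.
Qed.

(** An edge with ends [u] and [w] stands for the fat faces [u |: r] and [w |: r], adjacent along
    [r]. *)
Definition crossings j r : cplx V := EAA (link X r) (set1 @: nbrs (fat j) r).

(** The index is that of the fat faces meeting in [r]; [r] itself has the size of level [j.+1]. *)
Definition thin j : cplx V := [set r in X | (#|r| + j.+1 == k.+1)%N &&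
  (r \notin fat j.+1)].

Definition degenerate : cplx V := [set t in facesn X k.+2 |
  [exists j : 'I_k.+1, exists r in thin j, exists e in crossings j r,
     e :|: r \subset t]].

Hypothesis skel : forall s, s \in X -> (#|s| < d)%N ->
  skel_expander (link X s) (d - #|s|) alpha.

(** Thinness is failure of the threshold, so [skel_expander_deg] applies with [c] equal to
    [eta ^+ (2 ^ j)]; as [alpha] is no larger, [4 * d] doubles. *)
Lemma crossings_sum j r : (j <= k)%N -> r \in thin j ->
  \sum_(e in crossings j r) deg (e :|: r) <=
  (8 * d)%:R * eta ^+ (2 ^ j) * \sum_(v in nbrs (fat j) r) deg (v |: r).
Proof.
move=> jk; rewrite inE => /and3P[rX /eqP cr rF].
have rd : (#|r| < d)%N by lia.
have e0 : 0 <= eta ^+ (2 ^ j) by rewrite exprn_ge0 // ltW.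
have c : \sum_(v in nbrs (fat j) r) deg (v |: r) <= eta ^+ (2 ^ j) * deg r.
  apply: ltW; rewrite ltNge; apply: contra rF => h.
  by rewrite inE rX cr eqxx.
apply: le_trans
  (skel_expander_deg hX rX rd (fat_sub j) alpha_ge0 e0 (skel rX rd) c) _.
apply: ler_wpM2r; first by apply: sumr_ge0 => v _; apply: deg_ge0.
rewrite (_ : 8 * d = 4 * d * 2)%N ?(natrM _ (4 * d)); last by lia.
rewrite -[leRHS]mulrA; apply: ler_wpM2l => //.
by rewrite mulr_natl mulr2n lerD2l alpha_le.
Qed.

(** A union bound over level, thin face and crossing. Supersets cost [2 ^ d.+1], crossings [8 * d],
    charging fat faces to thin ones below them [d.+1]; [fat_sum] costs a power of [d.+1] and turns
    [eta ^+ (2 ^ j)] into [eta]. *)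
Lemma degenerate_sum : \sum_(t in degenerate) deg t <=
  (2 ^ d.+1 * (8 * d) * d.+1 ^ d.+2)%:R * (eta * \sum_(s in A) deg s).
Proof.
have DA0 : 0 <= eta * \sum_(s in A) deg s.
  by apply: mulr_ge0; [exact: ltW|apply: sumr_ge0 => s _; apply: deg_ge0].
pose Q j r (t : {set V}) := [exists e in crossings j r,
     e :|: r \subset t].
have step j : (j <= k)%N ->
    \sum_(r in thin j) \sum_(t | Q j r t) deg t <=
    (2 ^ d.+1 * (8 * d) * d.+1 ^ d.+1)%:R * (eta * \sum_(s in A) deg s).
  move=> jk.
  apply: (@le_trans _ R (\sum_(r in thin j) (2 ^ d.+1 * (8 * d))%:R *
      eta ^+ (2 ^ j) * \sum_(v in nbrs (fat j) r) deg (v |: r))).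
    apply: ler_sum => r rt.
    apply: (@le_trans _ R (\sum_(e in crossings j r)
        \sum_(t : {set V} | e :|: r \subset t) deg t)).
      apply: sum_cover => [t|t]; first exact: deg_ge0.
      by move=> /exists_inP[e]; exists e.
    apply: (@le_trans _ R (\sum_(e in crossings j r)
        (2 ^ d.+1)%:R * deg (e :|: r))).
      by apply: ler_sum => e _; apply: sum_deg_supersets.
    rewrite -mulr_sumr natrM -2!mulrA; apply: ler_wpM2l => //.
    by rewrite mulrA; apply: crossings_sum.
  rewrite -mulr_sumr.
  have h : \sum_(r in thin j) \sum_(v in nbrs (fat j) r) deg (v |: r) <=
           d.+1%:R * \sum_(s in fat j) deg s.
    apply: le_trans (sum_add_vertex (mem (thin j)) (deg_ge0 R X d) _).
      apply: ler_sum => r _.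
      by rewrite le_eqVlt; apply/orP; left; apply/eqP/eq_bigl => v; rewrite inE.
    by move=> s /(subsetP (fat_sub j)); have [_ _ + _] := hX; apply.
  rewrite [X in _ <= X * _]natrM -!mulrA; apply: ler_wpM2l => //.
  apply: le_trans (ler_wpM2l _ h) _; first by rewrite exprn_ge0 // ltW.
  rewrite mulrCA [X in _ * X]mulrC mulr_suml.
  apply: le_trans (ler_wpM2l (ler0n _ _) (fat_sum j)) _.
  rewrite [leLHS]mulrA -natrX -natrM; apply: ler_wpM2r => //; rewrite ler_nat -expnS.
  by rewrite leq_exp2l //; lia.
apply: (@le_trans _ R (\sum_(j < k.+1) \sum_(t |
    [exists r in thin j, Q j r t]) deg t)).
  apply: sum_cover => [t|t]; first exact: deg_ge0.
  by rewrite inE => /andP[_ /existsP[j]]; exists j.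
apply: (@le_trans _ R (\sum_(j < k.+1)
   (2 ^ d.+1 * (8 * d) * d.+1 ^ d.+1)%:R * (eta * \sum_(s in A) deg s))).
  apply: ler_sum => j _; apply: le_trans (step j (ltn_ord j)).
  apply: sum_cover => [t|t]; first exact: deg_ge0.
  by move=> /exists_inP[r]; exists r.
rewrite sumr_const card_ord -[leLHS]mulr_natl [leLHS]mulrA -natrM; apply: ler_wpM2r => //.
by rewrite ler_nat [(d.+1 ^ d.+2)%N]expnS mulnCA leq_mul2l leq_mul2r ltnS (ltnW kd) !orbT.
Qed.

(** If [r] were thin, [[set u; w]] would be a crossing at [r] inside [t]. *)
Lemma nondegenerate_cap_closed t : t \in facesn X k.+2 -> t \notin degenerate ->
  cap_closed_in fat t.
Proof.
move=> tX; rewrite inE tX negb_exists => /forallP nd j r u w uw ur wr uF wF uwt.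
have [_ dcl _ _] := hX; have [tX' _] := facesnP _ _ _ tX.
have [rX cr] := fat_card uF; rewrite cardsU1 ur in cr.
(* A face of level [j] containing [u] is nonempty, which keeps [j] in the range used by
   [degenerate]. *)
have jk : (j < k.+1)%N by rewrite -cr add1n addSn ltnS leq_addl.
have := nd (Ordinal jk); rewrite negb_exists => /forallP/(_ r) /=.
rewrite negb_and => /orP[|].
  rewrite inE (dcl _ _ tX') ?(subset_trans _ uwt) ?subsetUr //=.
  by rewrite (_ : #|r| + j.+1 == k.+1)%N /= ?negbK // -cr add1n addSnnS.
rewrite negb_exists => /forallP/(_ [set u; w]); rewrite uwt andbT.
have inN v : v \in [set u; w] -> [set v] \in set1 @: nbrs (fat j) r.
  by move=> vuw; apply: imset_f; rewrite inE; move: vuw; rewrite !inE;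
    move=> /orP[] /eqP->; rewrite ?ur ?wr.
rewrite !inE cards2 uw andbT /= => /negP[]; rewrite andbC; apply/andP; split.
  by apply/forall_inP => v; apply: inN.
rewrite (dcl _ _ tX' uwt) (dcl _ _ tX' (subset_trans (subsetUl _ _) uwt)) !andbT.
by rewrite disjoint_sym disjoints_subset; apply/subsetP => x xr;
  rewrite !inE negb_or; apply/andP; split; apply: contraTneq xr => ->.
Qed.

End FatFaces.

(** * Coboundary expansion in the links of terminal faces *)

Lemma bin_leq_exp2 n m : ('C(n, m) <= 2 ^ n)%N.
Proof.
elim: n m => [[|m]|n IH [|m]] //; first by rewrite bin0 expn_gt0.
by rewrite binS expnS mul2n -addnn leq_add.
Qed.

Section LocalExpansion.
Variables (V : finType) (R : realFieldType).
Variables (X : cplx V) (d : nat).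
Hypothesis hX : is_dcomplex d X.
Variables (k : nat) (A : cplx V) (beta b : R).
Hypothesis kd : (k < d)%N.
Hypothesis Ak : A \subset facesn X k.+1.
Hypotheses (b_ge0 : 0 <= b) (b_beta : b <= beta) (b_le1 : b <= 1).
Hypothesis cobx : forall s : {set V}, s \in X -> (0 < #|s|)%N -> (#|s| < d)%N ->
  cob_expander (link X s) (d - #|s|) beta.
Hypothesis lmin : locally_minimal R X d k A.
Implicit Types (a s t r : {set V}) (B : cplx V) (j : nat).

Local Notation deg := (deg R X d).

Lemma link_setU_inj s : {in link X s &, injective (fun t => t :|: s)}.
Proof.
move=> t u /linkP[_ dt _] /linkP[_ du _] e.
by rewrite -(setU_disjointK dt) -(setU_disjointK du) e.
Qed.

Lemma imset_loc s B : B \subset X -> (forall a, a \in B -> s \subset a) ->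
  [set t :|: s | t in loc X s B] = B.
Proof.
have [_ dcl _ _] := hX.
move=> /subsetP BX sB; apply/setP => a; apply/imsetP/idP => [[t]|aB].
  by rewrite inE => /andP[_ tB] ->.
exists (a :\: s); last by rewrite setDUK ?sB.
rewrite inE setDUK ?sB // aB andbT; apply/linkP.
rewrite setDUK ?sB // disjoint_setD; split=> //; last exact: BX.
exact: dcl (BX _ aB) (subsetDl _ _).
Qed.

Lemma sum_loc s B : B \subset X -> (forall a, a \in B -> s \subset a) ->
  \sum_(t in loc X s B) deg (t :|: s) = \sum_(a in B) deg a.
Proof.
move=> BX sB; rewrite -[in RHS](imset_loc BX sB) big_imset //=.
by move=> t u; rewrite !inE => /andP[tl _] /andP[ul _];
  apply: link_setU_inj; rewrite inE.
Qed.

(** Every facet containing [s] has a further vertex. *)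
Lemma deg_le_sum_vertices s : (#|s| <= d)%N ->
  deg s <= \sum_(t in facesn (link X s) 1) deg (t :|: s).
Proof.
have [_ dcl _ _] := hX.
move=> sd; rewrite degE; under [leRHS]eq_bigr do rewrite degE.
rewrite [leLHS](eq_bigl (mem [set F in facesn X d.+1 | s \subset F])); last first.
  by move=> F; rewrite [RHS]inE.
apply: sum_cover => // F; rewrite inE => /andP[/[dup] FX /facesnP[FX' cF] sF].
have /card_gt0P[v] : (0 < #|F :\: s|)%N.
  by have := cardsID s F; rewrite (setIidPr sF) cF; lia.
rewrite inE => /andP[vs vF]; exists [set v]; last first.
  by rewrite FX subUset sub1set vF.
have vsF : [set v] :|: s \subset F by rewrite subUset sub1set vF.
apply/facesnP; rewrite cards1; split=> //; apply/linkP; rewrite disjoints1 vs.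
split=> //; first by apply: dcl FX' _; rewrite sub1set.
exact: dcl FX' _.
Qed.

(** The localization of [B] is a subset of the minimal [loc X s A], so the link expands it; clearing
    denominators leaves a ratio of binomials, at most [2 ^ d.+1]. *)
Lemma local_expansion s B : s \in X -> (0 < #|s|)%N -> (#|s| <= k.+1)%N ->
  B \subset A -> (forall a, a \in B -> s \subset a) ->
  b * \sum_(a in B) deg a <= (2 ^ d.+1)%:R *
  \sum_(t in delta (link X s) (k.+1 - #|s|) (loc X s B)) deg (t :|: s).
Proof.
move=> sX s0 sk BA sB.
have AX : A \subset X by apply/subsetP => a /(subsetP Ak)/facesnP[].
have BX := subset_trans BA AX.
have SB0 : 0 <= \sum_(a in B) deg a by apply: sumr_ge0 => a _; apply: deg_ge0.
have Sd0 : 0 <= \sum_(t in delta (link X s) (k.+1 - #|s|) (loc X s B))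
                  deg (t :|: s).
  by apply: sumr_ge0 => a _; apply: deg_ge0.
have [sk'|sk'] := leqP #|s| k.
  have sd : (#|s| < d)%N by apply: leq_ltn_trans kd.
  have En : (k.+1 - #|s| = (k - #|s|).+1)%N by rewrite subSn.
  rewrite -(sum_loc BX sB); rewrite -(sum_loc BX sB) in SB0.
  have Lf : loc X s B \subset facesn (link X s) (k - #|s|).+1.
    apply/subsetP => t; rewrite inE => /andP[tl tB].
    apply/facesnP; split=> //.
    have /linkP[_ dts _] := tl.
    have /facesnP[_] := subsetP Ak _ (subsetP BA _ tB).
    by rewrite card_setU_disjoint // => e; rewrite -subSn // -e addnK.
  have Df : delta (link X s) (k - #|s|).+1 (loc X s B) \subset
            facesn (link X s) (k - #|s|).+2.
    by apply/subsetP => t; rewrite inE => /andP[].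
  have LL : loc X s B \subset loc X s A.
    by apply/subsetP => t; rewrite !inE => /andP[-> /(subsetP BA)].
  have mA := lmin sX; rewrite -card_gt0 En in mA.
  have be0 : 0 <= beta by apply: le_trans b_beta.
  have nm : (k - #|s| < d - #|s|)%N by rewrite ltn_sub2r.
  have := expander_minimal_subset be0 (cobx sX s0 sd) nm Lf LL (mA s0).
  rewrite (norm_link R hX (ltnW sd) Lf) (norm_link R hX (ltnW sd) Df).
  rewrite En in Sd0 *; move: SB0 Sd0; set SB := \sum_(t in loc _ _ _) _.
  set SD := \sum_(t in delta _ _ _) _ => SB0 SD0.
  have D0 := deg_gt0 R hX sX.
  set C1 := 'C(_, (k - _).+1); set C2 := 'C(_, _).
  have C10 : 0 < C1%:R :> R by rewrite ltr0n bin_gt0 ltnW.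
  have C20 : 0 < C2%:R :> R by rewrite ltr0n bin_gt0.
  rewrite mulrA ler_pdivrMr ?mulr_gt0 //.
  have -> : SD / (C2%:R * deg s) * (C1%:R * deg s) = SD / C2%:R * C1%:R.
    by field; rewrite !gt_eqF.
  move=> h; apply: (@le_trans _ R (beta * SB)); first exact: ler_wpM2r.
  apply: le_trans h _; rewrite mulrC; apply: ler_pM => //.
  - by rewrite divr_ge0.
  - by rewrite ler_nat (leq_trans (bin_leq_exp2 _ _)) // leq_exp2l // ltnS leq_subr.
  - by rewrite ler_pdivrMr // ler_peMr // ler1n -(ltr0n R).
(* Here [s] is the only possible member of [B]. Its localization is the empty face, whose coboundary
   is the set of all vertices of the link, so [deg_le_sum_vertices] replaces expansion. *)
have cs : #|s| = k.+1 by apply/eqP; rewrite eqn_leq sk.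
have [->|/set0Pn[a aB]] := eqVneq B set0.
  by rewrite big_set0 mulr0 mulr_ge0 // sumr_ge0 // => t _; apply: deg_ge0.
have Bs a' : a' \in B -> a' = s.
  move=> a'B; have /facesnP[_ ca] := subsetP Ak _ (subsetP BA _ a'B).
  by apply/esym/eqP; rewrite eqEcard sB //= ca cs.
have BE : B = [set s].
  by apply/eqP; rewrite eqEsubset sub1set -{2}(Bs _ aB) aB andbT;
    apply/subsetP => a' /Bs ->; rewrite inE.
have LE : loc X s B = [set set0].
  have [X0 _ _ _] := hX.
  apply/setP => t; rewrite !inE BE !inE; apply/idP/eqP => [|->].
    move=> /andP[/and3P[_ dt _] /eqP e].
    by rewrite -(setU_disjointK dt) e setDv.
  by rewrite set0U eqxx X0 sX -setI_eq0 set0I eqxx.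
rewrite LE cs subnn BE big_set1.
have -> : delta (link X s) 0 [set set0] = facesn (link X s) 1.
  apply/setP => t; rewrite [LHS]inE; case: (t \in facesn _ _) => //=.
  rewrite (_ : [set _ in _ | _] = [set set0]) ?cards1 //.
  apply/setP => u; rewrite !inE; case: eqP => //= ->.
  by rewrite sub0set cards0.
apply: le_trans (ler_wpM2r (deg_ge0 R X d s) b_le1) _; rewrite mul1r.
apply: le_trans (deg_le_sum_vertices _) _; first by rewrite cs.
rewrite ler_peMl //; last by rewrite ler1n expn_gt0.
by apply: sumr_ge0 => t _; apply: deg_ge0.
Qed.

Variables (eta : R).
Hypothesis fat0 : set0 \notin fat X d k A eta k.+1.

Local Notation fat := (fat X d k A eta).
Local Notation degenerate := (degenerate X d k A eta).

(** The set [L_s] of the overview; the size of [s] determines its level. *)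
Definition ladder_base s : cplx V := [set a in A | ladder fat (k.+1 - #|s|) a s].

(** By parity [t :|: s] contains a member of [ladder_base s]. If it is nondegenerate,
    [ladder_switch_terminal] carries the ladder over to every face of [A] inside it, so both
    coboundaries count the same faces. *)
Lemma delta_ladder_base s t : terminal fat (k.+1 - #|s|) s ->
  t \in delta (link X s) (k.+1 - #|s|) (loc X s (ladder_base s)) ->
  t :|: s \in delta X k.+1 A :|: degenerate.
Proof.
set j := (k.+1 - #|s|)%N => ts; rewrite inE => /andP[/facesnP[tl ct] ot].
have /andP[sF _] := ts.
have [sX cs] := fat_card Ak sF.
have /linkP[_ dts tsX] := tl.
have tsf : t :|: s \in facesn X k.+2.
  by apply/facesnP; split=> //; rewrite card_setU_disjoint // ct addSn addnC cs.
rewrite in_setU; have [|nd] := boolP (t :|: s \in degenerate).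
  by rewrite orbT.
have mt := nondegenerate_cap_closed hX Ak tsf nd.
have subA a : a \in A -> a \subset t :|: s ->
    exists2 u, u \in t :|: s & a = (t :|: s) :\ u.
  move=> /(subsetP Ak)/facesnP[_ ca] ats; apply: subset_codim1 => //.
  by have /facesnP[_ ->] := tsf; rewrite ca.
set Q := [set _ in _ | _] in ot.
have /set0Pn[x xQ] : Q != set0.
  by apply: contraTneq ot => ->; rewrite cards0.
have allL a : a \in A -> a \subset t :|: s -> a \in ladder_base s.
  move=> aA ats; rewrite inE aA.
  move: xQ; rewrite !inE => /andP[/andP[_ /andP[xA lx]] /andP[xt _]].
  have [u ut ea] := subA _ aA ats.
  have [v vt ex] := subA _ xA (setSU s xt).
  rewrite ex in lx xA; rewrite ea in aA *.
  exact: (ladder_switch_terminal mt vt ut).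
apply/orP; left; rewrite inE tsf /=.
suff -> : [set a in A | (a \subset t :|: s) && (#|a| == k.+1)] =
          [set u :|: s | u in Q].
  have Ql u : u \in Q -> u \in link X s.
    by rewrite /Q inE => /andP[+ _]; rewrite inE => /andP[].
  by rewrite card_in_imset // => u v /Ql ul /Ql vl; apply: link_setU_inj.
have [_ dcl _ _] := hX.
apply/setP => a; apply/idP/imsetP => [|[u]].
  rewrite inE => /and3P[aA ats /eqP ca].
  have aL := allL _ aA ats.
  have sa : s \subset a by move: aL; rewrite inE => /andP[_ /ladder_sub].
  have aX : a \in X by apply: dcl tsX _.
  exists (a :\: s); last by rewrite setDUK.
  rewrite inE; apply/and3P; split.
  - rewrite inE setDUK // aL andbT; apply/linkP; rewrite setDUK //.
    by rewrite disjoint_setD; split=> //; apply: dcl aX (subsetDl _ _).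
  - by rewrite subDset setUC.
  - by have := cardsID s a; rewrite (setIidPr sa) ca /j => <-; rewrite addKn.
rewrite !inE => /andP[/andP[_ /andP[uA _]] /andP[ut _]] ->.
by rewrite uA setSU //=; have /facesnP[_ ->] := subsetP Ak _ uA.
Qed.

(** Sum [local_expansion] over the terminal faces, whose ladder bases cover [A]. The second
    [2 ^ d.+1] bounds the number of terminal faces inside one [t]. *)
Lemma ladder_expansion : b * \sum_(a in A) deg a <= (2 ^ d.+1 * 2 ^ d.+1)%:R *
  (\sum_(t in delta X k.+1 A) deg t + \sum_(t in degenerate) deg t).
Proof.
set U := delta X k.+1 A :|: degenerate.
pose T := [set s : {set V} | terminal fat (k.+1 - #|s|) s].
(* As the empty face is not fat, terminal faces are nonempty, and local minimality applies to
   them. *)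
have gen s : s \in T -> [/\ s \in X, (0 < #|s|)%N & (#|s| <= k.+1)%N].
  rewrite inE => /andP[sF _]; have [sX cs] := fat_card Ak sF; split=> //.
    rewrite card_gt0; apply: contraNneq fat0 => e.
    by rewrite e cards0 subn0 in sF.
  by rewrite -cs leq_addr.
have cover : \sum_(a in A) deg a <= \sum_(s in T) \sum_(a in ladder_base s) deg a.
  apply: sum_cover => [a|a aA]; first exact: deg_ge0.
  have [|j [s /andP[ts ls]]] := exists_terminal (n := k.+1) (F := fat) aA.
    by move=> j jk; apply/setP => s; rewrite [RHS]inE; apply/negP => /(fat_card Ak)[_ cs];
      move: jk; rewrite -cs ltnNge leq_addl.
  have [_ cs] := fat_card Ak (ladder_in ls).
  have ej : (k.+1 - #|s| = j)%N by rewrite -cs addKn.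
  by exists s; rewrite inE ej // aA.
have loc s : s \in T -> b * \sum_(a in ladder_base s) deg a <=
    (2 ^ d.+1)%:R * \sum_(t in U | s \subset t) deg t.
  move=> sT; have [sX s0 sk] := gen _ sT; rewrite inE in sT.
  have LA : ladder_base s \subset A by apply/subsetP => a; rewrite inE => /andP[].
  have Ls a : a \in ladder_base s -> s \subset a.
    by rewrite inE => /andP[_ /ladder_sub].
  apply: le_trans (local_expansion sX s0 sk LA Ls) _; apply: ler_wpM2l => //.
  set W := delta _ _ _.
  have -> : \sum_(t in W) deg (t :|: s) = \sum_(t in [set t :|: s | t in W]) deg t.
    rewrite big_imset //= => t u tW uW; apply: link_setU_inj.
      by move: tW; rewrite inE => /andP[/facesnP[]].
    by move: uW; rewrite inE => /andP[/facesnP[]].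
  rewrite [leRHS](bigID (mem [set t :|: s | t in W])) /=.
  rewrite -[leLHS]addr0; apply: lerD; last first.
    by apply: sumr_ge0 => t _; apply: deg_ge0.
  rewrite le_eqVlt; apply/orP; left; apply/eqP/eq_bigl => t.
  apply/idP/andP => [tW|[]//]; split=> //.
  by case/imsetP: tW => u uW ->; rewrite subsetUr delta_ladder_base.
apply: le_trans (ler_wpM2l b_ge0 cover) _; rewrite mulr_sumr.
apply: le_trans (ler_sum _ loc) _; rewrite -mulr_sumr natrM -mulrA.
apply: ler_wpM2l => //.
have UX t : t \in U -> (#|t| <= d.+1)%N.
  have [_ _ + _] := hX => Xd.
  by rewrite !inE => /orP[] /andP[/andP[/Xd]].
have -> : \sum_(s in T) \sum_(t in U | s \subset t) deg t =
  \sum_(t in U) \sum_(s in T | s \subset t) deg t.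
  rewrite (exchange_big_dep (mem U)) /=; last by move=> s t _ /andP[].
  by apply: eq_bigr => t tU; apply: eq_bigl => s; rewrite tU.
apply: (@le_trans _ R (\sum_(t in U) (2 ^ d.+1)%:R * deg t)).
  apply: ler_sum => t tU; rewrite sumr_const -[leLHS]mulr_natl.
  apply: ler_wpM2r; first exact: deg_ge0.
  rewrite ler_nat; apply: (@leq_trans (2 ^ #|t|)%N); last by rewrite leq_exp2l ?UX.
  rewrite -card_powerset; apply: subset_leq_card; apply/subsetP => s.
  by rewrite [in X in _ -> X]inE unfold_in /= => /andP[].
rewrite -mulr_sumr; apply: ler_wpM2l => //.
rewrite /U (big_setID (delta X k.+1 A)) /= setUK lerD2l setDUl setDv set0U.
rewrite [leRHS](big_setID (delta X k.+1 A)) /= lerDr.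
by apply: sumr_ge0 => t _; apply: deg_ge0.
Qed.

End LocalExpansion.

(** * Choice of the constants and final estimate *)

Unset Implicit Arguments.

Theorem mainTheorem3 (R : realFieldType) (d : nat) (beta : R) :
  0 < beta ->
  exists (eps mu alpha : R), [/\ 0 < eps, 0 < mu, 0 < alpha &
    forall (V : finType) (X : cplx V),
      is_dcomplex d X ->
      (forall sg : {set V}, sg \in X -> (0 < #|sg|)%N -> (#|sg| < d)%N ->
         cob_expander (link X sg) (d - #|sg|) beta) ->
      (forall sg : {set V}, sg \in X -> (#|sg| < d)%N ->
         skel_expander (link X sg) (d - #|sg|) alpha) ->
      forall (k : nat) (A : cplx V), (k < d)%N ->
        A \subset facesn X k.+1 ->
        locally_minimal R X d k A ->
        norm R X d A <= mu ->
        eps * norm R X d A <= norm R X d (delta X k.+1 A)].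
Proof.
move=> beta0.
pose b := Num.min beta 1.
have b0 : 0 < b by rewrite lt_min beta0 ltr01.
have b1 : b <= 1 by rewrite ge_min lexx orbT.
have bbeta : b <= beta by rewrite ge_min lexx.
(* [P] bounds binomials and numbers of subsets, [K] is the constant of [degenerate_sum], and [Q]
   bounds the power of [d.+1] from [fat_sum]. *)
pose P : nat := (2 ^ d.+1)%N.
pose K : nat := (2 ^ d.+1 * (8 * d) * d.+1 ^ d.+2)%N.
pose Q : nat := (d.+1 ^ d)%N.
have P0 : 1 <= P%:R :> R by rewrite ler1n expn_gt0.
have Q0 : 1 <= Q%:R :> R by rewrite ler1n expn_gt0.
have PP0 : 0 <= (P * P)%:R * K%:R :> R by rewrite mulr_ge0.
(* With this value the degenerate faces consume at most half of [b]; the added [1] keeps the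
   denominator positive and [eta] at most [1]. *)
pose eta : R := b / (2 * ((P * P)%:R * K%:R + 1)).
have eta0 : 0 < eta by rewrite divr_gt0 // mulr_gt0 // ltr_wpDl.
have eta1 : eta <= 1.
  by rewrite /eta ler_pdivrMr ?mulr_gt0 ?ltr_wpDl // mul1r; lra.
have etaK : (P * P)%:R * K%:R * eta <= b / 2.
  have -> : eta = b / 2 / ((P * P)%:R * K%:R + 1).
    by rewrite /eta invfM mulrA.
  by rewrite mulrA ler_pdivrMr ?ltr_wpDl // mulrC ler_wpM2l ?divr_ge0 ?ltW ?ltrDl.
have eta_le i j : (i <= j)%N -> eta ^+ (2 ^ j) <= eta ^+ (2 ^ i).
  by move=> ij; rewrite ler_wiXn2l ?(ltW eta0) ?leq_exp2l.
exists (b / (2 * ((P * P)%:R * P%:R))), (eta ^+ (2 ^ d) / (2 * (Q%:R * P%:R))).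
(* As [alpha], this lies below every threshold [eta ^+ (2 ^ j)] with [j <= k]. *)
exists (eta ^+ (2 ^ d)).
have Pp : 0 < P%:R :> R by rewrite (lt_le_trans ltr01).
have Qp : 0 < Q%:R :> R by rewrite (lt_le_trans ltr01).
have e0 : 0 < eta ^+ (2 ^ d) by rewrite exprn_gt0.
split=> //; [by rewrite natrM divr_gt0 // !mulr_gt0|by rewrite divr_gt0 // !mulr_gt0|].
move=> V X hX cobx skel k A kd Ak lmin.
have Dk : delta X k.+1 A \subset facesn X k.+2.
  by apply/subsetP => t; rewrite inE => /andP[].
rewrite (norm_deg R d Ak) (norm_deg R d Dk).
have N0 : 0 < deg R X d set0 by apply: deg_gt0 => //; case: hX.
have bin_b m : (m <= d.+1)%N ->
    (1 <= 'C(d.+1, m)%:R :> R) && ('C(d.+1, m)%:R <= P%:R :> R).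
  by move=> md; rewrite ler1n bin_gt0 md ler_nat bin_leq_exp2.
have /andP[C1 C1P] := bin_b k.+1 (ltnW kd).
have /andP[C2 C2P] := bin_b k.+2 kd.
have fs := fat_sum hX Ak eta0.
have al j : (j <= k)%N -> eta ^+ (2 ^ d) <= eta ^+ (2 ^ j).
  by move=> jk; apply/eta_le/(leq_trans jk)/ltnW.
have dsum := degenerate_sum hX kd Ak eta0 (ltW e0) al skel.
have lexp := @ladder_expansion _ _ _ _ hX k A beta b kd Ak (ltW b0) bbeta b1 cobx lmin eta.
have DA0 : 0 <= \sum_(t in A) deg R X d t by apply: sumr_ge0 => t _; apply: deg_ge0.
have DD0 : 0 <= \sum_(t in delta X k.+1 A) deg R X d t.
  by apply: sumr_ge0 => t _; apply: deg_ge0.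
move: (fs k.+1) dsum lexp DA0 DD0 N0 C1 C1P C2 C2P.
rewrite -/K -/P.
set N := deg R X d set0; set DA := \sum_(t in A) _.
set DD := \sum_(t in delta _ _ _) _; set DG := \sum_(t in degenerate _ _ _ _ _) _.
set c1 := 'C(_, _)%:R; set c2 := 'C(_, _)%:R.
move=> fsk dsum lexp DA0 DD0 N0 C1 C1P C2 C2P normA.
have c1p : 0 < c1 by apply: lt_le_trans C1.
have c2p : 0 < c2 by apply: lt_le_trans C2.
(* A fat empty face alone would contribute [N * eta ^+ (2 ^ k.+1)] to [fat_sum], while the bound on
   the norm of [A] allows at most half of that. *)
have fat0 : set0 \notin fat X d k A eta k.+1.
  apply/negP => F0.
  have h1 : N * eta ^+ (2 ^ k.+1) <= d.+1%:R ^+ k.+1 * (eta * DA).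
    apply: le_trans fsk; rewrite (bigD1 set0) //= lerDl.
    by apply: sumr_ge0 => s _; rewrite mulr_ge0 ?deg_ge0 // exprn_ge0 // ltW.
  have h2 : DA <= eta ^+ (2 ^ d) / (2 * (Q%:R * P%:R)) * (P%:R * N).
    move: normA; rewrite ler_pdivrMr ?mulr_gt0 // => h; apply: le_trans h _.
    apply: ler_wpM2l; first by rewrite divr_ge0 ?ltW // !mulr_gt0.
    by apply: ler_wpM2r => //; apply: ltW.
  have h3 : d.+1%:R ^+ k.+1 <= Q%:R :> R.
    by rewrite -natrX ler_nat leq_pexp2l.
  have h4 : N * eta ^+ (2 ^ k.+1) <=
            Q%:R * (eta ^+ (2 ^ d) / (2 * (Q%:R * P%:R)) * (P%:R * N)).
    apply: le_trans h1 _; apply: ler_pM => //.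
    - by rewrite exprn_ge0.
    - by rewrite mulr_ge0 // ltW.
    - by apply: le_trans h2; rewrite ler_piMl.
  have h5 := eta_le _ _ kd.
  have : N * eta ^+ (2 ^ k.+1) <= N * (eta ^+ (2 ^ k.+1) / 2).
    apply: le_trans h4 _.
    have -> : Q%:R * (eta ^+ (2 ^ d) / (2 * (Q%:R * P%:R)) * (P%:R * N)) =
      N * (eta ^+ (2 ^ d) / 2) by field; rewrite !gt_eqF.
    by apply: ler_wpM2l; [exact: ltW|lra].
  rewrite ler_pM2l // => h6.
  by have := exprn_gt0 (2 ^ k.+1) eta0; lra.
have PPp : 0 < (P * P)%:R :> R by rewrite natrM mulr_gt0.
have {lexp} key : b / 2 * DA <= (P * P)%:R * DD.
  have h1 := lexp fat0.
  have h2 : (P * P)%:R * DG <= b / 2 * DA.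
    apply: le_trans (ler_wpM2l (ler0n _ _) dsum) _.
    by rewrite [leLHS]mulrA [leLHS]mulrA; apply: ler_wpM2r.
  by rewrite mulrDr in h1; lra.
(* The norms have denominators [c1 * N] and [c2 * N]; it remains to use [1 <= c1] and [c2 <= P]. *)
apply: (@le_trans _ R (b / (2 * ((P * P)%:R * P%:R)) * (DA / N))).
  apply: ler_wpM2l; first by rewrite ltW // divr_gt0 // !mulr_gt0.
  by apply: ler_wpM2l => //; rewrite lef_pV2 ?posrE ?mulr_gt0 // ler_peMl // ltW.
apply: (@le_trans _ R (DD / (P%:R * N))); last first.
  by apply: ler_wpM2l => //; rewrite lef_pV2 ?posrE ?mulr_gt0 // ler_wpM2r // ltW.
have -> : b / (2 * ((P * P)%:R * P%:R)) * (DA / N) =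
  (b / 2 * DA) / ((P * P)%:R * (P%:R * N)) by field; rewrite !gt_eqF.
rewrite ler_pdivrMr ?mulr_gt0 //; apply: le_trans key _.
rewrite le_eqVlt; apply/orP; left; apply/eqP; field.
by rewrite !gt_eqF.
Qed.
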